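(* Assume the reduced operator $\widehat A_h\in\mathbb{R}^{n_h\times n_h}$ is square and invertible. For every admissible comparison vector $U_h^\pi=U_{0,h}+Z_hy_h^\pi$ ($y_h^\pi\in\mathbb{R}^{n_h}$), with $\tau_h^\pi:=A_hU_h^\pi-b_h=\widehat A_hy_h^\pi-\widehat b_h$, $$\ell_{i,h}^\top U_h^\star-u^\star(x_i)=-g_{i,h}^\top\tau_h^\pi+\bigl(\ell_{i,h}^\top U_h^\pi-u^\star(x_i)\bigr).$$ Consequently, $$|\ell_{i,h}^\top(U_h^\star-U_h^\pi)|=|g_{i,h}^\top\tau_h^\pi|\le\sigma_{i,h}\|\tau_h^\pi\|_{W_h},$$ and, if $T_h\ge\|\tau_h^\pi\|_{W_h}$ and $\varepsilon_{i,h}^{\mathrm{eval}}\ge|\ell_{i,h}^\top U_h^\pi-u^\star(x_i)|$, then $$|\ell_{i,h}^\top U_h^\star-u^\star(x_i)|\le|g_{i,h}^\top\tau_h^\pi|+\varepsilon_{i,h}^{\mathrm{eval}}\le\mu_{i,h},\qquad \mu_{i,h}:=\sigma_{i,h}T_h+\varepsilon_{i,h}^{\mathrm{eval}}.$$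
   Context: Let $\Omega\subset\mathbb{R}^d$ be a bounded domain and $u^\star$ the exact solution (assumed unique in its admissible class) of a boundary-value problem on $\Omega$, with $u^\star(x_i)$ well defined at a query point $x_i\in\overline\Omega$. Let $U_{0,h}\in\mathbb{R}^{N_h}$ and let $Z_h\in\mathbb{R}^{N_h\times n_h}$ have full column rank; the admissible set is $U_{0,h}+Z_h\mathbb{R}^{n_h}$. Let $A_h\in\mathbb{R}^{M_h\times N_h}$, $b_h\in\mathbb{R}^{M_h}$, $\widehat A_h:=A_hZ_h$, $\widehat b_h:=b_h-A_hU_{0,h}$. In the square setting $M_h=n_h$. Let $W_h\in\mathbb{R}^{M_h\times M_h}$ be symmetric positive definite, $\|r\|_{W_h}:=(r^\top W_hr)^{1/2}$, $\|g\|_{W_h^{-1}}:=(g^\top W_h^{-1}g)^{1/2}$, $\widehat H_h:=\widehat A_h^\top W_h\widehat A_h$. The discrete target is $y_h^\star:=\widehat A_h^{-1}\widehat b_h$, $U_h^\star:=U_{0,h}+Z_hy_h^\star$. To the query $x_i$ is attached a query vector $\ell_{i,h}\in\mathbb{R}^{N_h}$ (the discrete query value of a coefficient vector $U$ is $\ell_{i,h}^\top U$); put $\widehat\ell_{i,h}:=Z_h^\top\ell_{i,h}$, let $q_{i,h}$ solve $\widehat H_hq_{i,h}=\widehat\ell_{i,h}$, and define $g_{i,h}:=W_h\widehat A_hq_{i,h}$, $\sigma_{i,h}:=\|g_{i,h}\|_{W_h^{-1}}$. *)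

(* Defs.v *)
From HB Require Import structures.
From mathcomp Require Import all_boot all_order all_algebra.
From mathcomp Require Import all_classical all_reals all_analysis.
Set Implicit Arguments.
Unset Strict Implicit.
Unset Printing Implicit Defensive.
Import Order.TTheory GRing.Theory Num.Theory numFieldNormedType.Exports.
Local Open Scope classical_set_scope.
Local Open Scope ring_scope.

Section BoundaryValueProblem.
Context (R : realType) (d : nat).

Definition bounded_domain (Omega : set 'rV[R]_d) : Prop :=
  [/\ Omega !=set0, open Omega, connected Omega & bounded_set Omega].

(* A scalar boundary-value problem: an admissible class together with an
   arbitrary interior condition and an arbitrary boundary condition, each of
   which may depend on the whole function and on the point. A condition that
   ignores the point covers weak formulations. Functions are total on R^d; only
   their values on the closure of the domain matter. *)
Record bvp := BVP {
  bvp_class : set ('rV[R]_d -> R);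
  bvp_interior : ('rV[R]_d -> R) -> 'rV[R]_d -> Prop;
  bvp_boundary : ('rV[R]_d -> R) -> 'rV[R]_d -> Prop
}.

Definition bvp_solution (Omega : set 'rV[R]_d) (P : bvp) (u : 'rV[R]_d -> R) :
    Prop :=
  [/\ bvp_class P u,
      forall x, Omega x -> bvp_interior P u x
    & forall x, (closure Omega `\` Omega) x -> bvp_boundary P u x].

Definition bvp_exact_solution (Omega : set 'rV[R]_d) (P : bvp)
    (u : 'rV[R]_d -> R) : Prop :=
  bvp_solution Omega P u /\
  forall v, bvp_solution Omega P v -> {in closure Omega, v =1 u}.

End BoundaryValueProblem.

Section Algebra.
Context (R : realType).

Definition dotc k (u v : 'cV[R]_k) : R := (u^T *m v) 0 0.

Definition spd k (W : 'M[R]_k) : Prop :=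
  W^T = W /\ forall v : 'cV[R]_k, v != 0 -> 0 < dotc v (W *m v).

Definition wnorm k (W : 'M[R]_k) (r : 'cV[R]_k) : R :=
  Num.sqrt (dotc r (W *m r)).

Context (M N n : nat).

Definition lift_coord (U0 : 'cV[R]_N) (Z : 'M[R]_(N, n)) (y : 'cV[R]_n) :
  'cV[R]_N := U0 + Z *m y.

Definition reduced_op (A : 'M[R]_(M, N)) (Z : 'M[R]_(N, n)) : 'M[R]_(M, n) :=
  A *m Z.

Definition reduced_rhs (A : 'M[R]_(M, N)) (b : 'cV[R]_M) (U0 : 'cV[R]_N) :
  'cV[R]_M := b - A *m U0.

Definition normal_op (A : 'M[R]_(M, N)) (Z : 'M[R]_(N, n)) (W : 'M[R]_M) :
    'M[R]_n :=
  (reduced_op A Z)^T *m W *m reduced_op A Z.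

Definition reduced_query (Z : 'M[R]_(N, n)) (l : 'cV[R]_N) : 'cV[R]_n :=
  Z^T *m l.

Definition query_weight (A : 'M[R]_(M, N)) (Z : 'M[R]_(N, n)) (W : 'M[R]_M)
    (q : 'cV[R]_n) : 'cV[R]_M :=
  W *m reduced_op A Z *m q.

Definition query_sigma (A : 'M[R]_(M, N)) (Z : 'M[R]_(N, n)) (W : 'M[R]_M)
    (q : 'cV[R]_n) : R :=
  wnorm (invmx W) (query_weight A Z W q).

End Algebra.

Section SquareTarget.
Context (R : realType) (N n : nat).

Definition target_coord (A : 'M[R]_(n, N)) (b : 'cV[R]_n) (U0 : 'cV[R]_N)
    (Z : 'M[R]_(N, n)) : 'cV[R]_n :=
  invmx (reduced_op A Z) *m reduced_rhs A b U0.

Definition target (A : 'M[R]_(n, N)) (b : 'cV[R]_n) (U0 : 'cV[R]_N)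
    (Z : 'M[R]_(N, n)) : 'cV[R]_N :=
  lift_coord U0 Z (target_coord A b U0 Z).

End SquareTarget.

(* Main.v *)
(** The dual weight [g = W A^ q] represents the query functional on residuals:
with [A^ (y* - y) = - tau], the normal equation [A^^T W A^ q = Z^T l] turns
[l^T Z (y* - y)] into [g^T A^ (y* - y) = - g^T tau].  The bound is the
Cauchy-Schwarz inequality for the inner product of [W], because [g = W w] has
dual norm equal to the [W]-norm of [w = A^ q]. *)
Require Import Defs.
From HB Require Import structures.
From mathcomp Require Import all_boot all_order all_algebra.
From mathcomp Require Import all_classical all_reals all_analysis.
From mathcomp Require Import ring.
Import Order.TTheory GRing.Theory Num.Theory numFieldNormedType.Exports.
Local Open Scope classical_set_scope.
Local Open Scope ring_scope.

Lemma dotcC (R : realType) k (u v : 'cV[R]_k) : dotc u v = dotc v u.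
Proof. by rewrite /dotc -[v^T *m u]trmxK trmx_mul trmxK [RHS]mxE. Qed.

Lemma dotcDr (R : realType) k (u v w : 'cV[R]_k) :
  dotc u (v + w) = dotc u v + dotc u w.
Proof. by rewrite /dotc mulmxDr mxE. Qed.

Lemma dotcNr (R : realType) k (u v : 'cV[R]_k) : dotc u (- v) = - dotc u v.
Proof. by rewrite /dotc mulmxN mxE. Qed.

Lemma dotcZr (R : realType) k (a : R) (u v : 'cV[R]_k) :
  dotc u (a *: v) = a * dotc u v.
Proof. by rewrite /dotc -scalemxAr mxE. Qed.

Lemma dotc_adj (R : realType) m k (B : 'M[R]_(m, k)) (u : 'cV[R]_m)
    (v : 'cV[R]_k) : dotc u (B *m v) = dotc (B^T *m u) v.
Proof. by rewrite /dotc trmx_mul trmxK mulmxA. Qed.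

Lemma dotc0r (R : realType) k (u : 'cV[R]_k) : dotc u 0 = 0.
Proof. by rewrite /dotc mulmx0 mxE. Qed.

Lemma spd_ge0 (R : realType) k (W : 'M[R]_k) (v : 'cV[R]_k) :
  spd W -> 0 <= dotc v (W *m v).
Proof.
move=> [_ Wpos]; have [->|/Wpos/ltW//] := eqVneq v 0.
by rewrite mulmx0 dotc0r.
Qed.

Lemma spd_sym (R : realType) k (W : 'M[R]_k) (u v : 'cV[R]_k) :
  spd W -> dotc u (W *m v) = dotc v (W *m u).
Proof. by move=> [Wsym _]; rewrite dotc_adj Wsym dotcC. Qed.

(** A nonzero row [v] of the left kernel would give [v *m W *m v^T = 0], against positivity at the
    column [v^T]. *)
Lemma spd_unitmx (R : realType) k (W : 'M[R]_k) : spd W -> W \in unitmx.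
Proof.
move=> [_ Wpos]; rewrite -row_free_unit -kermx_eq0.
apply/eqP/row_matrixP => i; rewrite row0; apply/eqP/contraT => v_neq0.
set v := row i (kermx W) in v_neq0 *.
have vW0 : v *m W = 0 by apply/sub_kermxP/row_sub.
have := Wpos v^T; rewrite trmx_eq0 => /(_ v_neq0).
by rewrite /dotc trmxK mulmxA vW0 mul0mx mxE ltxx.
Qed.

Lemma spd_cauchy_schwarz (R : realType) k (W : 'M[R]_k) (u v : 'cV[R]_k) :
  spd W -> `|dotc u (W *m v)| <= wnorm W u * wnorm W v.
Proof.
(* Both sides become square roots, so it suffices to compare the radicands. *)
move=> Wspd; rewrite /wnorm -sqrtrM ?spd_ge0// -sqrtr_sqr.
apply: ler_wsqrtr.
have [->|u_neq0] := eqVneq u 0.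
  by rewrite spd_sym// mulmx0 !dotc0r expr0n mul0r.
have a_gt0 : 0 < dotc u (W *m u) by have [_ ->] := Wspd.
(* Multiplying the gap by [a > 0] avoids dividing by [a] in the projection of [v] onto [u]. *)
rewrite -subr_ge0 -(pmulr_rge0 _ a_gt0).
set a := dotc u (W *m u) in a_gt0 *; set e := dotc u (W *m v).
(* The vector [a *: v - e *: u] is [a] times the part of [v] that is [W]-orthogonal to [u]; its
   quadratic form is nonnegative. *)
have -> : a * (a * dotc v (W *m v) - e ^+ 2)
    = dotc (a *: v - e *: u) (W *m (a *: v - e *: u)).
  rewrite mulmxBr -!scalemxAr dotcDr dotcNr !dotcZr.
  rewrite ![dotc (_ - _) _]dotcC !dotcDr !dotcNr !dotcZr.
  rewrite ![dotc (W *m _) _]dotcC (spd_sym _ _ _ v u Wspd) -/a -/e; ring.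
exact: spd_ge0.
Qed.

Lemma wnorm_dual (R : realType) k (W : 'M[R]_k) (w : 'cV[R]_k) :
  spd W -> wnorm (invmx W) (W *m w) = wnorm W w.
Proof.
move=> Wspd; congr Num.sqrt.
by rewrite mulKmx ?spd_unitmx// dotcC.
Qed.

Lemma residual_reduced (R : realType) M N n (A : 'M[R]_(M, N)) (b : 'cV[R]_M)
    (U0 : 'cV[R]_N) (Z : 'M[R]_(N, n)) (y : 'cV[R]_n) :
  A *m lift_coord U0 Z y - b = reduced_op A Z *m y - reduced_rhs A b U0.
Proof.
by rewrite /reduced_op /reduced_rhs /lift_coord mulmxDr mulmxA opprB addrA
  [A *m U0 + _]addrC.
Qed.

Lemma query_error (R : realType) N n (U0 : 'cV[R]_N) (Z : 'M[R]_(N, n))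
    (A : 'M[R]_(n, N)) (b : 'cV[R]_n) (W : 'M[R]_n) (l : 'cV[R]_N)
    (q y : 'cV[R]_n) :
  reduced_op A Z \in unitmx ->
  normal_op A Z W *m q = reduced_query Z l ->
  dotc l (target A b U0 Z - lift_coord U0 Z y) =
  - dotc (query_weight A Z W q) (A *m lift_coord U0 Z y - b).
Proof.
move=> Aunit Hq; rewrite residual_reduced.
(* The offset [U0] cancels, so the difference lies in the range of [Z]. *)
have -> : target A b U0 Z - lift_coord U0 Z y
    = Z *m (target_coord A b U0 Z - y).
  by rewrite /target /lift_coord mulmxBr opprD addrACA subrr add0r.
rewrite dotc_adj -[Z^T *m l]Hq /normal_op /query_weight /target_coord.
(* An opaque [B] keeps the reassociation below from splitting the reduced operator into [A *m Z]. *)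
move: (reduced_op A Z) Aunit {Hq} => B Bunit.
(* Moving [B^T] across the pairing as [B] cancels the inverse in the target and leaves minus the
   residual. *)
by rewrite -!mulmxA -dotc_adj mulmxBr mulKVmx// -dotcNr opprB.
Qed.

Theorem proposition4p4 (R : realType) (d : nat) (Omega : set 'rV[R]_d)
    (P : bvp R d) (ustar : 'rV[R]_d -> R) (x : 'rV[R]_d)
    (N n : nat) (U0 : 'cV[R]_N) (Z : 'M[R]_(N, n))
    (A : 'M[R]_(n, N)) (b : 'cV[R]_n) (W : 'M[R]_n)
    (l : 'cV[R]_N) (q : 'cV[R]_n)
    (hOmega : bounded_domain Omega)
    (hustar : bvp_exact_solution Omega P ustar)
    (hx : closure Omega x)
    (hZ : \rank Z = n)
    (hW : spd W)
    (hA : reduced_op A Z \in unitmx)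
    (hq : normal_op A Z W *m q = reduced_query Z l) :
  let g := query_weight A Z W q in
  let sigma := query_sigma A Z W q in
  let Ustar := target A b U0 Z in
  forall ypi : 'cV[R]_n,
  let Upi := lift_coord U0 Z ypi in
  let tau := A *m Upi - b in
  [/\ tau = reduced_op A Z *m ypi - reduced_rhs A b U0,
      dotc l Ustar - ustar x = - dotc g tau + (dotc l Upi - ustar x),
      `|dotc l (Ustar - Upi)| = `|dotc g tau|,
      `|dotc g tau| <= sigma * wnorm W tau
    & forall T eps : R,
        wnorm W tau <= T -> `|dotc l Upi - ustar x| <= eps ->
        let mu := sigma * T + eps in
        `|dotc l Ustar - ustar x| <= `|dotc g tau| + eps /\
        `|dotc g tau| + eps <= mu].
Proof.
move=> g sigma Ustar ypi Upi tau.
have err : dotc l (Ustar - Upi) = - dotc g tau.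
  exact: query_error.
have bound : `|dotc g tau| <= sigma * wnorm W tau.
  (* Reassociation exhibits [g] as [W] applied to [reduced_op A Z *m q], whose [W]-norm is then
     [sigma]. *)
  rewrite /sigma /query_sigma /g /query_weight -mulmxA wnorm_dual//.
  by rewrite dotcC spd_sym// spd_cauchy_schwarz.
have split_err : dotc l Ustar - ustar x = - dotc g tau + (dotc l Upi - ustar x).
  by rewrite -err dotcDr dotcNr addrA subrK.
split=> //; first exact: residual_reduced.
- by rewrite err normrN.
- move=> T eps leT leeps; split.
    by rewrite split_err (le_trans (ler_normD _ _))// normrN lerD2l.
  (* Scaling the bound [T] by [sigma] preserves the order since [sigma] is a square root. *)
  by rewrite lerD2r (le_trans bound)// ler_wpM2l// sqrtr_ge0.
Qed.
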